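(* Let $A=\{x_1,x_2\}$ be an alphabet of two variables. For every positive integer $n$, $$\sum_{k=0}^{n}\binom{n}{k}(x_1-x_2)^{n-k}(n-k-1)\left(2^k\phi_k(x_1+x_2)+2(x_1+x_2)^k\right)G_{n-k}=-2n(n-1)(x_1-x_2)^2(x_1+x_2)^{n-2}.$$
   Context: Here $x_1,x_2$ are two commuting variables (indeterminates) and identities are in the field of rational functions in them. The notation $\phi_n(x_1+x_2)$ denotes the function of the alphabet $\{x_1,x_2\}$ (not of the sum) given by $\phi_n(x_1+x_2)=x_1^n+x_2^n$ for $n\ge 0$; the expression $(x_1+x_2)^k$ is the ordinary power of the sum. The Genocchi numbers $G_n$ are defined by $\sum_{n\ge 0}G_n\frac{z^n}{n!}=\frac{2z}{e^z+1}$. *)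

(* Defs.v *)
From HB Require Import structures.
From mathcomp Require Import all_boot all_order all_algebra.
From mathcomp Require Import mpoly.

Set Implicit Arguments.
Unset Strict Implicit.
Unset Printing Implicit Defensive.

Import GRing.Theory.
Local Open Scope ring_scope.

(* A formal power series over F is the sequence of its coefficients. *)
Section FormalPowerSeries.
Variable F : fieldType.
Implicit Types f g : nat -> F.

Definition fps_add f g : nat -> F := fun n => f n + g n.

Definition fps_mul f g : nat -> F :=
  fun n => \sum_(i < n.+1) f i * g (n - i)%N.

Definition fps_one : nat -> F := fun n => (n == 0%N)%:R.

(* The first n coefficients of 1 / f, obtained by solving
   f_0 h_m + \sum_(i < m) h_i f_(m - i) = [m = 0] for h_m. *)
Fixpoint fps_inv_prefix f (n : nat) : seq F :=
  if n is m.+1 then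
    let s := fps_inv_prefix f m in
    rcons s ((fps_one m - \sum_(i < m) s`_i * f (m - i)%N) / f 0%N)
  else [::].

Definition fps_inv f : nat -> F := fun n => (fps_inv_prefix f n.+1)`_n.

Definition fps_div f g : nat -> F := fps_mul f (fps_inv g).

Lemma size_fps_inv_prefix f n : size (fps_inv_prefix f n) = n.
Proof. by elim: n => //= n IHn; rewrite size_rcons IHn. Qed.

Lemma nth_fps_inv_prefix f n i :
  (i < n)%N -> (fps_inv_prefix f n)`_i = fps_inv f i.
Proof.
elim: n => // n IHn; rewrite ltnS leq_eqVlt => /orP[/eqP-> // | lt_in].
by rewrite /= nth_rcons size_fps_inv_prefix lt_in IHn.
Qed.

Lemma fps_mulVf f : f 0%N != 0 -> fps_mul (fps_inv f) f =1 fps_one.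
Proof.
move=> f0 m.
have prefixE : \sum_(i < m) (fps_inv_prefix f m)`_i * f (m - i)%N
               = \sum_(i < m) fps_inv f i * f (m - i)%N.
  by apply: eq_bigr => i _; rewrite nth_fps_inv_prefix.
rewrite /fps_mul big_ord_recr /= subnn {2}/fps_inv /=.
by rewrite nth_rcons size_fps_inv_prefix ltnn eqxx divfK // prefixE addrC subrK.
Qed.

Lemma fps_mulA f g h : fps_mul f (fps_mul g h) =1 fps_mul (fps_mul f g) h.
Proof.
move=> n; pose T (u : nat -> F) := \poly_(i < n.+1) u i.
have TE u i : (i < n.+1)%N -> (T u)`_i = u i by rewrite coef_poly => ->.
have mulE u v i : (i < n.+1)%N -> fps_mul u v i = (T u * T v)`_i.
  move=> lt_in; rewrite coefM; apply: eq_bigr => j _.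
  by rewrite !TE // (leq_ltn_trans _ lt_in) ?leq_subr // -ltnS.
transitivity (T f * (T g * T h))`_n.
  rewrite coefM; apply: eq_bigr => i _.
  by rewrite TE ?mulE // ltnS leq_subr.
rewrite mulrA coefM; apply: eq_bigr => i _.
by rewrite TE ?mulE // ltnS leq_subr.
Qed.

End FormalPowerSeries.

Definition fps_exp : nat -> rat := fun n => (n`!%:R)^-1.

Definition fps_2z : nat -> rat := fun n => (n == 1%N)%:R * 2%:R.

Definition genocchi (n : nat) : rat :=
  n`!%:R * fps_div fps_2z (fps_add fps_exp (@fps_one rat)) n.

Lemma genocchiP :
  fps_mul (fun n => genocchi n / n`!%:R) (fps_add fps_exp (@fps_one rat))
    =1 fps_2z.
Proof.
set E := fps_add _ _; move=> n.
have E0 : E 0%N != 0 by rewrite /E /fps_add /fps_exp /fps_one.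
transitivity (fps_mul (fps_div fps_2z E) E n).
  apply: eq_bigr => i _; congr (_ * _).
  rewrite /genocchi -/E mulrC mulKf //.
  by rewrite Num.Theory.pnatr_eq0 -lt0n fact_gt0.
rewrite /fps_div -fps_mulA.
transitivity (fps_mul fps_2z (@fps_one rat) n).
  by apply: eq_bigr => i _; rewrite fps_mulVf.
rewrite /fps_mul big_ord_recr /= subnn {2}/fps_one eqxx mulr1 big1 ?add0r //.
by move=> i _; rewrite /fps_one subn_eq0 leqNgt ltn_ord mulr0.
Qed.

Definition ratfrac2 (F : fieldType) : fieldType := {fraction {mpoly F[2]}}.

Definition ratvar (F : fieldType) (i : 'I_2) : ratfrac2 F := tofrac 'X_i.

(* An alphabet is the list of its letters: phi_n(x1 + x2) is
   written phi n [:: x1; x2]; there + denotes the union of alphabets, not the sum. *)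
Definition phi (K : fieldType) (n : nat) (A : seq K) : K :=
  \sum_(a <- A) a ^+ n.

(* Main.v *)
(** With s = x1 + x2 and d = x1 - x2 we have 2 x1 = s + d and 2 x2 = s - d, so
    the exponential generating function of 2^k phi_k + 2 s^k is
    e^(sz) (e^(dz) + 2 + e^(-dz)) = e^((s-d)z) (e^(dz) + 1)^2.
    The sequence (m - 1) d^m G_m has generating function (z d/dz - 1) g for
    g = 2dz / (e^(dz) + 1); applying z d/dz to g (e^(dz) + 1) = 2dz shows that
    this is - g dz e^(dz) / (e^(dz) + 1).  The product is -2 d^2 z^2 e^(sz). *)
From Stdlib Require Import FunctionalExtensionality.
Require Import Defs.
From mathcomp Require Import all_boot all_order all_algebra.
From mathcomp Require Import mpoly.
From mathcomp Require Import ring.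

Import GRing.Theory.
Local Open Scope ring_scope.

(** * Rational numbers in a field of characteristic zero *)

Section Ratr.
Variables (K : fieldType) (charK : [pchar K] =i pred0).

Lemma natr_neq0 (n : nat) : n != 0%N -> n%:R != 0 :> K.
Proof. by move/pcharf0P: charK => ->. Qed.

Lemma intr_neq0 (z : int) : z != 0 -> z%:~R != 0 :> K.
Proof.
case: z => n z0; first by rewrite natr_neq0.
by rewrite NegzE mulrNz oppr_eq0 natr_neq0.
Qed.

(** [ratr] uses the reduced fraction, while [m / d] need not be reduced. Denominators stay nonzero
    in [K], so cross-multiplication leaves an identity of integers, checked in [rat]. *)
Lemma ratr_frac (m d : int) :
  d != 0 -> ratr (m%:~R / d%:~R) = m%:~R / d%:~R :> K.
Proof.
move=> d0; set q : rat := _ / _.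
apply/eqP; rewrite /ratr eqr_div ?intr_neq0 ?denq_neq0 // -!intrM.
suff -> : numq q * d = m * denq q by [].
apply: (@intr_inj rat); rewrite !intrM; apply/eqP.
by rewrite -eqr_div ?divq_num_den // intr_eq0 ?denq_neq0.
Qed.

Lemma ratrD : {morph @ratr K : x y / x + y}.
Proof.
move=> x y; rewrite -[x in LHS]divq_num_den -[y in LHS]divq_num_den.
rewrite addf_div ?intr_eq0 ?denq_neq0 // -!intrM -intrD.
rewrite ratr_frac ?mulf_neq0 ?denq_neq0 //.
by rewrite intrD !intrM -addf_div ?intr_neq0 ?denq_neq0.
Qed.

Lemma ratrM : {morph @ratr K : x y / x * y}.
Proof.
move=> x y; rewrite -[x in LHS]divq_num_den -[y in LHS]divq_num_den.
rewrite mulf_div -!intrM ratr_frac ?mulf_neq0 ?denq_neq0 //.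
by rewrite !intrM -mulf_div.
Qed.

Lemma ratr_sum (I : Type) (r : seq I) (f : I -> rat) :
  ratr (\sum_(i <- r) f i) = \sum_(i <- r) ratr (f i) :> K.
Proof. exact: (big_morph _ ratrD (ratr_nat _ 0)). Qed.

Lemma ratr_natV (n : nat) : n != 0%N -> ratr n%:R^-1 = n%:R^-1 :> K.
Proof.
move=> n0; have := ratr_frac 1 n%:Z n0.
by rewrite !mul1r.
Qed.

End Ratr.

(** * Formal power series: products, Euler operator, exponentials *)

Section Series.
Variable K : fieldType.
Implicit Types (f g h : nat -> K) (a b : K).

Lemma fps_mulC f g : fps_mul f g = fps_mul g f.
Proof.
apply: functional_extensionality => n.
rewrite /fps_mul (reindex_inj rev_ord_inj); apply: eq_bigr => i _ /=.
by rewrite subSS subKn 1?mulrC // -ltnS.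
Qed.

Lemma fps_mulA_eq f g h : fps_mul f (fps_mul g h) = fps_mul (fps_mul f g) h.
Proof. exact/functional_extensionality/fps_mulA. Qed.

Lemma fps_mulCA f g h : fps_mul f (fps_mul g h) = fps_mul g (fps_mul f h).
Proof. by rewrite fps_mulA_eq (fps_mulC f) -fps_mulA_eq. Qed.

Lemma fps_mulDr f g h :
  fps_mul f (fps_add g h) = fps_add (fps_mul f g) (fps_mul f h).
Proof.
apply: functional_extensionality => n.
rewrite /fps_mul /fps_add -big_split; apply: eq_bigr => i _ /=.
by rewrite mulrDr.
Qed.

Definition fps_scale a f : nat -> K := fun n => a * f n.

Lemma fps_mulZr a f g : fps_mul f (fps_scale a g) = fps_scale a (fps_mul f g).
Proof.
apply: functional_extensionality => n.
rewrite /fps_mul /fps_scale mulr_sumr; apply: eq_bigr => i _.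
by rewrite mulrCA.
Qed.

Lemma fps_mul1 f : fps_mul f (@fps_one K) = f.
Proof.
apply: functional_extensionality => n.
rewrite /fps_mul big_ord_recr /= subnn {2}/fps_one eqxx mulr1 big1 ?add0r //.
by move=> i _; rewrite /fps_one subn_eq0 leqNgt ltn_ord mulr0.
Qed.

Definition fps_linear a : nat -> K := fun n => (n == 1%N)%:R * a.

Lemma fps_mul_linear a f n :
  fps_mul (fps_linear a) f n = if n is m.+1 then a * f m else 0.
Proof.
case: n => [|m]; rewrite /fps_mul /fps_linear.
  by rewrite big_ord1 mul0r mul0r.
rewrite 2!big_ord_recl big1 /= => [|i _]; last by rewrite !mul0r.
by rewrite !mul0r mul1r add0r addr0 subSS subn0.
Qed.

(** The derivation z d/dz, which, unlike d/dz, shifts no index. *)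
Definition fps_euler f : nat -> K := fun n => n%:R * f n.

Lemma fps_eulerM f g :
  fps_euler (fps_mul f g) =
  fps_add (fps_mul (fps_euler f) g) (fps_mul f (fps_euler g)).
Proof.
apply: functional_extensionality => n.
rewrite /fps_euler /fps_mul /fps_add mulr_sumr -big_split.
apply: eq_bigr => i _ /=.
have -> : n%:R = i%:R + (n - i)%:R :> K by rewrite -natrD subnKC // -ltnS.
by ring.
Qed.

Definition fps_expZ a : nat -> K := fun n => a ^+ n / n`!%:R.

Section CharZero.
Hypothesis charK : [pchar K] =i pred0.

Lemma fact_neq0 (n : nat) : n`!%:R != 0 :> K.
Proof. by rewrite natr_neq0 // -lt0n fact_gt0. Qed.

Lemma fps_expZD a b : fps_mul (fps_expZ a) (fps_expZ b) = fps_expZ (a + b).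
Proof.
apply: functional_extensionality => n.
(* [exprDn] puts the exponent [n - i] on the first summand, hence the swap. *)
rewrite /fps_mul /fps_expZ addrC exprDn mulr_suml; apply: eq_bigr => i _.
have lein : (i <= n)%N by rewrite -ltnS.
apply: (canRL (mulfK (fact_neq0 n))).
rewrite -(bin_fact lein) !natrM -mulr_natr.
by field; rewrite !fact_neq0.
Qed.

Lemma fps_euler_expZ a :
  fps_euler (fps_expZ a) = fps_mul (fps_linear a) (fps_expZ a).
Proof.
apply: functional_extensionality => n; rewrite fps_mul_linear /fps_euler.
case: n => [|n]; first by rewrite mul0r.
rewrite /fps_expZ factS natrM exprS.
by field; rewrite fact_neq0 nat1r natr_neq0.
Qed.

(** The series 2az / (e^(az) + 1). *)
Definition fps_genocchi a : nat -> K :=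
  fun n => a ^+ n * ratr (genocchi n) / n`!%:R.

(** This is [genocchiP] carried into [K] by [ratr], with z replaced by az: the coefficient of index
    [n] gains the factor [a ^+ n]. *)
Lemma fps_genocchiP a :
  fps_mul (fps_genocchi a) (fps_add (fps_expZ a) (@fps_one K)) =
  fps_linear (2%:R * a).
Proof.
apply: functional_extensionality => n.
transitivity (a ^+ n * ratr (fps_2z n)); last first.
  rewrite /fps_linear /fps_2z ratrM // !ratr_nat.
  by case: eqP => [->|_] /=; ring.
rewrite -genocchiP /fps_mul ratr_sum // mulr_sumr; apply: eq_bigr => i _.
have lein : (i <= n)%N by rewrite -ltnS.
rewrite ratrM //= ratrM // ratrD // !ratr_natV -?lt0n ?fact_gt0 // ratr_nat.
rewrite /fps_genocchi /fps_add /fps_expZ /fps_one.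
have -> : a ^+ n = a ^+ i * a ^+ (n - i) by rewrite -exprD subnKC.
case: eqP => [->|_] /=; field; by rewrite ?fact_neq0.
Qed.

(** Keeping the factor [w] avoids dividing series. *)
Lemma fps_genocchi_euler a (w := fps_add (fps_expZ a) (@fps_one K)) :
  fps_mul w (fps_add (fps_euler (fps_genocchi a))
                     (fps_scale (-1) (fps_genocchi a))) =
  fps_scale (-1)
    (fps_mul (fps_mul (fps_linear a) (fps_expZ a)) (fps_genocchi a)).
Proof.
have euler_w : fps_euler w = fps_mul (fps_linear a) (fps_expZ a).
  rewrite -fps_euler_expZ; apply: functional_extensionality => n.
  by rewrite /fps_euler /w /fps_add /fps_one; case: n => [|n] /=; ring.
rewrite fps_mulDr fps_mulZr (fps_mulC w (fps_genocchi a)) fps_genocchiP.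
rewrite -euler_w; apply: functional_extensionality => n.
have := congr1 (fun f => f n) (fps_eulerM (fps_genocchi a) w).
rewrite fps_genocchiP /fps_add /fps_scale (fps_mulC w) (fps_mulC (fps_euler w)).
(* z d/dz fixes 2az, so this term cancels against the one from [fps_scale (-1)]. *)
have -> : fps_euler (fps_linear (2%:R * a)) n = fps_linear (2%:R * a) n.
  by rewrite /fps_euler /fps_linear; case: eqP => [->|_] /=; ring.
by move=> ->; ring.
Qed.

(** One factor [w] serves [fps_genocchi_euler]; the other turns the remaining Genocchi series into
    2dz. The exponentials then merge into e^(sz). *)
Lemma fps_genocchi_exp s d (w := fps_add (fps_expZ d) (@fps_one K)) :
  fps_mul (fps_mul (fps_expZ (s - d)) (fps_mul w w))
    (fps_add (fps_euler (fps_genocchi d)) (fps_scale (-1) (fps_genocchi d))) =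
  fps_scale (-1)
    (fps_mul (fps_linear d) (fps_mul (fps_linear (2%:R * d)) (fps_expZ s))).
Proof.
rewrite -!fps_mulA_eq fps_genocchi_euler !fps_mulZr; congr fps_scale.
rewrite (fps_mulCA w) (fps_mulC w) fps_genocchiP.
rewrite -fps_mulA_eq fps_mulCA (fps_mulC (fps_expZ d)).
by rewrite (fps_mulCA (fps_expZ (s - d))) fps_expZD subrK.
Qed.

Lemma fps_expZ_sqr s d (w := fps_add (fps_expZ d) (@fps_one K)) (n : nat) :
  fps_mul (fps_expZ (s - d)) (fps_mul w w) n =
  ((s + d) ^+ n + (s - d) ^+ n + 2%:R * s ^+ n) / n`!%:R.
Proof.
rewrite /w !fps_mulDr !fps_mul1 !(fps_mulC (fps_add _ _) (fps_expZ d)).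
rewrite !fps_mulDr !fps_mul1 !fps_expZD !addrA subrK /fps_add /fps_expZ.
by ring.
Qed.

(** Compares the coefficients of z^n in [fps_genocchi_exp], multiplied by n!. It holds for arbitrary
    elements of [K], even when [x1 + x2] is zero. *)
Lemma genocchi_sum (x1 x2 : K) (n : nat) : (0 < n)%N ->
  \sum_(0 <= k < n.+1)
     'C(n, k)%:R * (x1 - x2) ^+ (n - k) * (n%:R - k%:R - 1)
     * (2%:R ^+ k * phi k [:: x1; x2] + 2%:R * (x1 + x2) ^+ k)
     * ratr (genocchi (n - k))
  = - 2%:R * n%:R * (n%:R - 1) * (x1 - x2) ^+ 2 * (x1 + x2) ^ (n%:Z - 2).
Proof.
move=> n_gt0; set s := x1 + x2; set d := x1 - x2.
have := congr1 (fun f => n`!%:R * f n) (fps_genocchi_exp s d).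
rewrite [X in X = _ -> _]mulr_sumr big_mkord => sumE.
transitivity (n`!%:R * fps_scale (-1) (fps_mul (fps_linear d)
    (fps_mul (fps_linear (2%:R * d)) (fps_expZ s))) n).
  rewrite -sumE; apply: eq_bigr => i _.
  have lein : (i <= n)%N by rewrite -ltnS.
  rewrite fps_expZ_sqr /fps_add /fps_euler /fps_scale /fps_genocchi.
  rewrite -(bin_fact lein) !natrM natrB //.
  (* Here [s + d] is 2 x1 and [s - d] is 2 x2. *)
  have -> : 2%:R ^+ i * phi i [:: x1; x2] = (s + d) ^+ i + (s - d) ^+ i.
    rewrite /phi !big_cons big_nil addr0 mulrDr -!exprMn.
    by congr (_ ^+ i + _ ^+ i); rewrite /s /d; ring.
  by field; rewrite !fact_neq0.
rewrite /fps_scale fps_mul_linear.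
(* For [n = 1] the exponent on the right is -1, but both sides vanish: the series has a factor z^2,
   and [n - 1] is zero. From 2 on, the exponent is a natural number. *)
case: n n_gt0 {sumE} => // -[|n] _; rewrite fps_mul_linear.
  by rewrite subrr; ring.
have -> : n.+2%:Z - 2 = n%:Z by rewrite -addn2 PoszD addrK.
rewrite -exprnP /fps_expZ !factS !natrM -!natr1.
by field; rewrite fact_neq0.
Qed.

End CharZero.
End Series.

(** Natural numbers are constant polynomials, and both embeddings, into polynomials and into
    fractions, are injective. *)
Lemma pchar_ratfrac2 (F : fieldType) :
  [pchar F] =i pred0 -> [pchar ratfrac2 F] =i pred0.
Proof.
move/pcharf0P=> charF; apply/pcharf0P => n.
by rewrite -(rmorph_nat (@tofrac {mpoly F[2]})) tofrac_eq0 -mpolyC_nat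
           mpolyC_eq0 charF.
Qed.

Theorem theorem4 (F : fieldType) (charF : [pchar F] =i pred0)
    (n : nat) (n_gt0 : (0 < n)%N) :
  let x1 : ratfrac2 F := ratvar F 0 in
  let x2 : ratfrac2 F := ratvar F 1 in
  \sum_(0 <= k < n.+1)
     'C(n, k)%:R * (x1 - x2) ^+ (n - k) * (n%:R - k%:R - 1)
     * (2%:R ^+ k * phi k [:: x1; x2] + 2%:R * (x1 + x2) ^+ k)
     * ratr (genocchi (n - k))
  = - 2%:R * n%:R * (n%:R - 1) * (x1 - x2) ^+ 2 * (x1 + x2) ^ (n%:Z - 2).
Proof. by move=> x1 x2; apply: genocchi_sum => //; apply: pchar_ratfrac2. Qed.
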